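(* Let $m\ge 2$ and $r\ge 1$ be integers, let $\alpha_0,\ldots,\alpha_{r-1}\in\mathbb{C}$ be pairwise distinct, let $c_0,\ldots,c_{r-1}\in\mathbb{C}\setminus\{0\}$, and let $\mathcal{N}>0$ be the constant normalizing the single-mode state $\frac1{\mathcal{N}}\sum_{k=0}^{r-1}c_k|\alpha_k\rangle$. Let $$|\Psi\rangle=\frac{1}{\mathcal{N}}\sum_{k=0}^{r-1}c_k\,|\beta_k\rangle^{\otimes m},\qquad \beta_k=\alpha_k/\sqrt m,$$ be the output of a balanced $m$-port beam-splitter with input $\frac1{\mathcal{N}}\sum_{k=0}^{r-1}c_k|\alpha_k\rangle\otimes|0,\ldots,0\rangle$. Then $|\Psi\rangle$ is SLOCC-equivalent to the $m$-partite GHZ state $$|GHZ_{(r)}\rangle=\frac{|0\rangle^{\otimes m}+|1\rangle^{\otimes m}+\cdots+|r-1\rangle^{\otimes m}}{\sqrt r},$$ where $|0\rangle,\ldots,|r-1\rangle$ here denote number states.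
   Context: The state space is $\mathcal{H}=\mathcal{H}_1\otimes\cdots\otimes\mathcal{H}_m$, where each mode space $\mathcal{H}_k$ is a copy of the Fock space with orthonormal number basis $|0\rangle,|1\rangle,|2\rangle,\ldots$. For $\alpha\in\mathbb{C}$ the coherent state is $|\alpha\rangle=e^{-|\alpha|^2/2}\sum_{n\ge0}\frac{\alpha^n}{\sqrt{n!}}|n\rangle$ (equivalently $e^{\alpha a^\dagger-\alpha^*a}|0\rangle$, with $a,a^\dagger$ the annihilation and creation operators); kets labelled by $\alpha_k,\beta_k$ are coherent states. A balanced $m$-port beam-splitter is represented by a unitary $U_S$ which fixes the vacuum and satisfies $U_Sa_1^\dagger U_S^\dagger=(a_1^\dagger+\cdots+a_m^\dagger)/\sqrt m$; it maps $|\alpha\rangle\otimes|0,\ldots,0\rangle$ to $|\alpha/\sqrt m\rangle^{\otimes m}$. Two (possibly unnormalized) vectors $|\Psi\rangle,|\Phi\rangle\in\mathcal{H}$ are SLOCC-equivalent if there are invertible operators $A_k$ on $\mathcal{H}_k$ (bounded with bounded inverse), $k=1,\ldots,m$, with $|\Phi\rangle=A_1\otimes\cdots\otimes A_m|\Psi\rangle$. *)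

(* Defs.v *)
From HB Require Import structures.
From mathcomp Require Import all_boot all_order all_algebra finmap.
From mathcomp Require Import complex ring lra.
From mathcomp Require Import all_classical all_reals all_analysis.
From mathcomp Require summability.
Set Implicit Arguments.
Unset Strict Implicit.
Unset Printing Implicit Defensive.
Import Order.TTheory GRing.Theory Num.Theory.
Import numFieldNormedType.Exports.
Local Open Scope classical_set_scope.
Local Open Scope ring_scope.
Local Open Scope complex_scope.

Lemma ler_sum_subset (R : realType) (I : choiceType) (J : {fset I}) (s : seq I)
    (F : I -> R) : (forall i, 0 <= F i) -> uniq s -> {subset J <= s} ->
  \sum_(i <- J) F i <= \sum_(i <- s) F i.
Proof.
move=> F0 us Js; rewrite [leRHS](bigID (mem J))/= -[X in _ <= X + _]big_filter.
have /(perm_big _)-> : perm_eq J [seq i <- s | i \in J].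
  apply: uniq_perm; rewrite ?filter_uniq ?fset_uniq// => i.
  by rewrite mem_filter andb_idr//; exact: Js.
by rewrite lerDl sumr_ge0.
Qed.

Section SquareSummable.
Variables (R : realType) (I : choiceType).
Implicit Types x y : I -> R[i].

Definition sqsum x : \bar R :=
  (\esum_(i in [set: I]) ((Normc.normc (x i)) ^+ 2)%:E)%E.

Definition sqsummable : pred (I -> R[i]) := fun x => (sqsum x < +oo)%E.

Lemma sqsummableP x :
  sqsummable x <->
  exists M : R, forall J : {fset I},
    \sum_(i <- J) (Normc.normc (x i)) ^+ 2 <= M.
Proof.
split=> [xfin|[M xM]].
  have sge0 : (0 <= sqsum x)%E.
    by apply: esum_ge0 => i _; rewrite lee_fin sqr_ge0.
  exists (fine (sqsum x)) => J.
  rewrite -lee_fin fineK ?ge0_fin_numE//.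
  apply: esum_ge; exists [set` J]; first by split.
  by rewrite fsbig_finite//= set_fsetK sumEFin.
apply: (@le_lt_trans _ _ M%:E); last exact: ltry.
apply: ge_ereal_sup => /= _ [A [finA _] <-].
by rewrite fsbig_finite//= sumEFin lee_fin.
Qed.

Lemma sqsummable_submod_closed : submod_closed sqsummable.
Proof.
split.
  rewrite unfold_in; apply/sqsummableP; exists 0 => J; rewrite big1// => i _.
  by rewrite [(0 : I -> R[i]) i]/(0 : R[i]) Normc.normc0 expr0n.
move=> a x y; rewrite !unfold_in => /sqsummableP[M xM] /sqsummableP[N yN].
apply/sqsummableP; exists (2 * Normc.normc a ^+ 2 * M + 2 * N) => J.
have -> : \sum_(i <- J) (Normc.normc ((a *: x + y) i)) ^+ 2 =
          \sum_(i <- J) (Normc.normc (a * x i + y i)) ^+ 2 by [].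
have a2 : 0 <= 2 * Normc.normc a ^+ 2 by rewrite mulr_ge0 ?sqr_ge0.
apply: le_trans (lerD (ler_wpM2l a2 (xM J)) (ler_wpM2l _ (yN J))) => //.
rewrite !mulr_sumr -big_split/= ler_sum// => i _.
have h : Normc.normc (a * x i + y i) <=
    Normc.normc a * Normc.normc (x i) + Normc.normc (y i).
  by rewrite -Normc.normcM; exact: le_normcD.
have s0 : 0 <= Normc.normc (a * x i + y i).
  by case: (_ + _) => ? ?; apply: sqrtr_ge0.
apply: (le_trans (lerXn2r 2 s0 (le_trans s0 h) h)).
set u := Normc.normc a; set v := Normc.normc (x i); set w := Normc.normc (y i).
rewrite -subr_ge0 (_ : _ - _ = (u * v - w) ^+ 2); last by ring.
exact: sqr_ge0.
Qed.

HB.instance Definition _ := GRing.isSubmodClosed.Build _ _ sqsummable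
  sqsummable_submod_closed.

Record l2 : Type := L2 { l2val :> I -> R[i]; l2valP : sqsummable l2val }.

HB.instance Definition _ := [isSub for l2val].
HB.instance Definition _ := [Choice of l2 by <:].
HB.instance Definition _ := [SubChoice_isSubLmodule of l2 by <:].

Definition l2norm (x : l2) : R := Num.sqrt (fine (sqsum x)).

(* Conjugate-linear in the first argument.  The library sum of a family is  *)
(* the limit of its partial sums along the finite subsets of I.             *)
Definition ip (x y : l2) : R[i] :=
  summability.sum (fun i => ((x i)^* * y i : R[i]^o)).

Lemma ket_sqsummable (i : I) : sqsummable (fun j => (j == i)%:R).
Proof.
apply/sqsummableP; exists 1 => J.
rewrite (eq_bigr (fun j => (j == i)%:R : R)); last first.
  move=> j _; case: (j == i); rewrite ?(Normc.normc0, Normc.normc1) ?expr1n//.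
  by rewrite expr0n.
have [iJ|iJ] := boolP (i \in J).
  rewrite (big_fsetD1 i)//= eqxx big_seq big1 ?addr0// => j.
  by rewrite !inE => /andP[/negbTE->].
rewrite big_seq big1 ?ler01// => j jJ; case: eqP => // ji.
by rewrite ji (negbTE iJ) in jJ.
Qed.

Definition ket (i : I) : l2 := L2 (ket_sqsummable i).

Lemma cvg_sum (f : I -> R[i]^o) (l : R[i]^o) :
  summability.partial_sum f @ summability.totally --> l -> summability.sum f = l.
Proof.
have F := @summability.totally_filter I.
by move=> fl; apply: cvg_lim fl; exact: norm_hausdorff.
Qed.

Lemma ip_ket (i j : I) : ip (ket i) (ket j) = (i == j)%:R.
Proof.
apply: cvg_sum.
have F := @summability.totally_filter I.
apply: cvg_near_cst.
exists [fset i]%fset => //= J /= iJ; apply/eqP.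
rewrite /summability.partial_sum.
rewrite -(big_seq_fsetE _ _ xpredT
  (fun k => ((k == i)%:R^* * (k == j)%:R : R[i])))/=.
rewrite (big_fsetD1 i) ?(fsubsetP iJ) ?inE//=.
rewrite eqxx conjC1 mul1r big_seq big1 ?addr0// => k.
by rewrite !inE => /andP[/negbTE-> _]; rewrite conjC0 mul0r.
Qed.

Lemma ip_norm (x : l2) : ip x x = (l2norm x ^+ 2)%:C.
Proof.
apply: cvg_sum.
have F := @summability.totally_filter I.
have s0 : (0 <= sqsum x)%E by apply: esum_ge0 => i _; rewrite lee_fin sqr_ge0.
have sfin : sqsum x \is a fin_num by rewrite ge0_fin_numE//; exact: l2valP.
rewrite sqr_sqrtr ?fine_ge0//.
apply/cvgrPdist_lt => /= e e0.
have [r r0 er] : exists2 r : R, 0 < r & e = r%:C.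
  move: e0; case: e => a b; rewrite ltcE/= => /andP[/eqP h a0].
  by exists a => //; rewrite h.
have [_ [A [finA _] <-] lt] := ub_ereal_sup_adherent r0 sfin.
have psE (J : {fset I}) :
    summability.partial_sum (fun i => ((x i)^* * x i : R[i]^o)) J =
    (\sum_(i <- J) Normc.normc (x i) ^+ 2)%:C.
  rewrite /summability.partial_sum.
  rewrite -(big_seq_fsetE _ _ xpredT (fun k => ((x k)^* * x k : R[i])))/=.
  rewrite rmorph_sum/=; apply: eq_bigr => i _.
  by rewrite mulrC -normCK rmorphXn/=; case: (x i).
exists (fset_set A) => //= J /= AJ.
rewrite psE -rmorphB/= er normc_def/= expr0n addr0 sqrtr_sqr ltcR.
have le1 : \sum_(i <- J) Normc.normc (x i) ^+ 2 <= fine (sqsum x).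
  rewrite -lee_fin fineK//; apply: esum_ge; exists [set` J]; first by split.
  by rewrite fsbig_finite//= set_fsetK sumEFin.
rewrite ger0_norm ?subr_ge0// ltrBlDr -ltrBlDl.
apply: (@lt_le_trans _ _ (\sum_(i <- fset_set A) Normc.normc (x i) ^+ 2)).
  move: lt; rewrite -[ereal_sup _]/(sqsum x) -(fineK sfin) -EFinB.
  by rewrite fsbig_finite//= sumEFin lte_fin.
apply: ler_sum_subset => //; first by move=> i; rewrite sqr_ge0.
exact/fsubsetP.
Qed.

End SquareSummable.

Section Operators.
Variables (R : realType) (I : choiceType).
Local Notation op := {linear l2 R I -> l2 R I}.

Definition bounded_op (A : op) : Prop :=
  exists M : R, forall x, l2norm (A x) <= M * l2norm x.

Definition bounded_invertible (A : op) : Prop :=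
  bounded_op A /\
  exists B : op, [/\ bounded_op B, cancel A B & cancel B A].

Definition unitary_op (U V : op) : Prop :=
  [/\ forall x y, ip (U x) y = ip x (V y), cancel U V & cancel V U].

End Operators.

Section Modes.
Variables (R : realType) (m : nat).

Definition fock := l2 R nat.

(* H_1 (x) ... (x) H_m is realised as l^2(N^m): the occupation vector n     *)
(* indexes the basis vector |n_1> (x) ... (x) |n_m>.                        *)
Definition occupation := {ffun 'I_m -> nat}.
Definition multimode := l2 R occupation.

Lemma tensor_sqsummable (f : 'I_m -> fock) :
  sqsummable (fun n : occupation => \prod_(k < m) f k (n k)).
Proof.
have fM k : exists M : R, forall N : nat,
    \sum_(j < N) (Normc.normc (f k j)) ^+ 2 <= M.
  have /sqsummableP[M fkM] := l2valP (f k); exists M => N.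
  have := fkM [fset j | j in index_iota 0 N]%fset.
  rewrite (perm_big (index_iota 0 N)) ?big_mkord//.
  apply: uniq_perm; rewrite ?fset_uniq ?iota_uniq// => j.
  by rewrite mem_imfset.
have [M MP] := choice fM.
apply/sqsummableP; exists (\prod_(k < m) M k) => J.
pose N := (\max_(n <- J) \max_(k < m) n k).+1.
pose toS (g : {ffun 'I_m -> 'I_N}) : occupation := [ffun k => val (g k)].
pose S := map toS (enum {ffun 'I_m -> 'I_N}).
have JS : {subset J <= S}.
  move=> n nJ; apply/mapP.
  have nN k : (n k < N)%N.
    rewrite ltnS (leq_trans (leq_bigmax k))//.
    exact: (@leq_bigmax_seq _ _ xpredT (fun n : occupation => \max_(k < m) n k)%N).
  exists [ffun k => Ordinal (nN k)]; first by rewrite mem_enum.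
  by apply/ffunP => k; rewrite !ffunE.
have uS : uniq S.
  rewrite map_inj_uniq ?enum_uniq// => g h /ffunP gh; apply/ffunP => k.
  by apply/val_inj; have := gh k; rewrite !ffunE.
pose F (n : occupation) := \prod_(k < m) (Normc.normc (f k (n k))) ^+ 2.
have F0 n : 0 <= F n by apply: prodr_ge0 => k _; rewrite sqr_ge0.
apply: (@le_trans _ _ (\sum_(n <- J) F n)).
  rewrite le_eqVlt; apply/orP; left; apply/eqP; apply: eq_bigr => n _.
  rewrite /F prodrXl; congr (_ ^+ 2).
  by elim/big_rec2: _ => [|k y1 y2 _ <-]; rewrite ?Normc.normc1 ?Normc.normcM.
apply: (@le_trans _ _ (\sum_(n <- S) F n)).
  exact: ler_sum_subset.
rewrite big_map big_enum/= /F.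
under eq_bigr do under eq_bigr do rewrite ffunE.
rewrite -(bigA_distr_bigA (fun k (j : 'I_N) => (Normc.normc (f k j)) ^+ 2)).
by apply: ler_prod => k _; rewrite MP andbT sumr_ge0// => j _; rewrite sqr_ge0.
Qed.

Definition tensor (f : 'I_m -> fock) : multimode := L2 (tensor_sqsummable f).

(* T is the operator A_1 (x) ... (x) A_m: a bounded operator is determined  *)
(* by its values on product vectors, which span a dense subspace.           *)
Definition is_tensor_op (A : 'I_m -> {linear fock -> fock})
    (T : {linear multimode -> multimode}) : Prop :=
  bounded_op T /\ forall f, T (tensor f) = tensor (fun k => A k (f k)).

Definition slocc_equivalent (Psi Phi : multimode) : Prop :=
  exists A : 'I_m -> {linear fock -> fock},
    (forall k, bounded_invertible (A k)) /\
    exists2 T : {linear multimode -> multimode},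
      is_tensor_op A T & Phi = T Psi.

Definition remove_one (k : 'I_m) (n : occupation) : occupation :=
  [ffun j => if j == k then (n j).-1 else n j].

(* y = a_k^dagger x, the unbounded operator a_k^dagger being given by its   *)
(* graph, with maximal domain: <n|y> = sqrt(n_k) <n - e_k|x>.               *)
Definition creation (k : 'I_m) (x y : multimode) : Prop :=
  forall n : occupation,
    y n = (Num.sqrt (n k)%:R)%:C * x (remove_one k n).

Definition vacuum : multimode := tensor (fun=> ket R 0%N).

(* U represents a balanced beam-splitter with input port k1, and V is its   *)
(* adjoint.  The relation U a_k1^dagger V = (sum_k a_k^dagger) / sqrt m     *)
(* between unbounded operators is required on the natural domain of the     *)
(* right-hand side, where all the a_k^dagger are defined.                   *)
Definition balanced_beam_splitter (k1 : 'I_m)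
    (U V : {linear multimode -> multimode}) : Prop :=
  [/\ unitary_op U V,
      U vacuum = vacuum &
      forall (x : multimode) (y : 'I_m -> multimode),
        (forall k, creation k x (y k)) ->
        exists2 z, creation k1 (V x) z &
          U z = ((Num.sqrt m%:R)^-1)%:C *: \sum_(k < m) y k].

(* f (x) |0,...,0>, with f in mode k1 *)
Definition one_port_input (k1 : 'I_m) (f : fock) : multimode :=
  tensor (fun k => if k == k1 then f else ket R 0%N).

Definition ghz (r : nat) : multimode :=
  ((Num.sqrt r%:R)^-1)%:C *: \sum_(j < r) tensor (fun=> ket R (j : nat)).

End Modes.

Section Coherent.
Variable R : realType.

Lemma coherent_sqsummable (alpha : R[i]) :
  sqsummable (fun n : nat =>
    (expR (- (Normc.normc alpha ^+ 2) / 2))%:C *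
      (alpha ^+ n / (Num.sqrt (n`!)%:R)%:C)).
Proof.
have H : (fun n : nat => alpha ^+ n / (Num.sqrt (n`!)%:R)%:C) \in @sqsummable R nat.
  rewrite unfold_in; apply/sqsummableP.
  pose t := Normc.normc alpha ^+ 2.
  have t0 : 0 <= t by rewrite sqr_ge0.
  exists (expR t) => J.
  have nE n : Normc.normc (alpha ^+ n / (Num.sqrt (n`!)%:R)%:C) ^+ 2 = exp_coeff t n.
    rewrite Normc.normcM Normc.normcV exprMn exprVn /exp_coeff/=; congr (_ / _).
      rewrite -exprM mulnC exprM; congr (_ ^+ 2).
      elim: n => [|n IH]; first by rewrite !expr0 Normc.normc1.
      by rewrite !exprS Normc.normcM IH.
    by rewrite expr0n addr0 sqr_sqrtr ?sqr_ge0// sqr_sqrtr.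
  rewrite (eq_bigr _ (fun n _ => nE n)).
  pose N := (\max_(n <- J) n).+1.
  apply: (@le_trans _ _ (series (exp_coeff t) N)); last first.
    apply: nondecreasing_cvgn_le; last exact: is_cvg_series_exp_coeff.
    by apply: nondecreasing_series => n _ _; apply: exp_coeff_ge0.
  apply: ler_sum_subset; first by move=> n; exact: exp_coeff_ge0.
    exact: iota_uniq.
  move=> n nJ; rewrite mem_index_iota /= ltnS.
  exact: (@leq_bigmax_seq _ _ xpredT id).
exact: (rpredZ _ H).
Qed.

Definition coherent (alpha : R[i]) : fock R := L2 (coherent_sqsummable alpha).

End Coherent.

(* Main.v *)
Require Import Defs.
From HB Require Import structures.
From mathcomp Require Import all_boot all_order all_algebra finmap.
From mathcomp Require Import complex ring.
From mathcomp Require Import all_classical all_reals all_analysis.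
From mathcomp Require summability.
Set Implicit Arguments.
Unset Strict Implicit.
Unset Printing Implicit Defensive.
Import Order.TTheory GRing.Theory Num.Theory.
Import numFieldNormedType.Exports.
Local Open Scope ring_scope.
Local Open Scope complex_scope.

(** SLOCC equivalence: the Vandermonde determinant of distinct amplitudes shows
    that the projections of r distinct coherent states to the span of
    |0>, ..., |r-1> form a basis of it.  Hence the finite-rank perturbation of
    the identity that sends |k> to a multiple of the k-th coherent state is
    invertible, with an inverse of the same form.  The tensor product of these
    inverses, one per mode, maps the state to GHZ; the coefficients are absorbed
    by the scaling in the first mode.

    Beam-splitter: the intertwining relation gives, by induction on N, the image
    of |N, 0, ..., 0>, whose entries are supported on the occupations with N
    photons in total.  Every matrix element of U on a one-port input therefore
    has a single nonzero term. *)

Local Arguments l2val : simpl never.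

(** * Coordinates and squared-norm estimates in the space of square-summable families *)

Section L2.
Variables (R : realType) (I : choiceType).
Implicit Types x y : l2 R I.

Lemma l2P x y : (forall i, x i = y i) -> x = y.
Proof. by move=> xy; apply/val_inj/funext => i; exact: xy. Qed.

Lemma l2DE x y i : (x + y) i = x i + y i. Proof. by []. Qed.

Lemma l2NE x i : (- x) i = - x i. Proof. by []. Qed.

Lemma l2ZE a x i : (a *: x) i = a * x i. Proof. by []. Qed.

Lemma l2_sumE (K : Type) (s : seq K) (P : pred K) (F : K -> l2 R I) i :
  (\sum_(k <- s | P k) F k) i = \sum_(k <- s | P k) F k i.
Proof. by apply: (big_morph (fun x : l2 R I => x i)). Qed.

Lemma ketE (i j : I) : ket R i j = (j == i)%:R. Proof. by []. Qed.

Lemma sqsum_ge0 (x : I -> R[i]) : (0 <= sqsum x)%E.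
Proof. by apply: esum_ge0 => i _; rewrite lee_fin sqr_ge0. Qed.

Lemma sqsum_fin_num x : sqsum x \is a fin_num.
Proof. by rewrite ge0_fin_numE ?sqsum_ge0//; exact: l2valP. Qed.

Lemma l2norm_ge0 x : 0 <= l2norm x.
Proof. exact: sqrtr_ge0. Qed.

Lemma l2norm_sqr x : ((l2norm x ^+ 2)%R%:E = sqsum x)%E.
Proof. by rewrite sqr_sqrtr ?fine_ge0 ?sqsum_ge0// fineK// sqsum_fin_num. Qed.

Lemma coord_le_l2norm x i : Normc.normc (x i) ^+ 2 <= l2norm x ^+ 2.
Proof.
rewrite -lee_fin l2norm_sqr; apply: esum_ge; exists [set i]%classic.
  by split => //; exact: finite_set1.
by rewrite fsbig_set1.
Qed.

Lemma esum_le_mull (T : choiceType) (P : set T) (M : R) (a : T -> \bar R) :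
  0 <= M -> (forall i, (0 <= a i)%E) ->
  (\esum_(i in P) (M%:E * a i) <= M%:E * \esum_(i in P) a i)%E.
Proof.
move=> M0 a0; apply: ge_ereal_sup => _ [X [finX XP] <-].
rewrite -ge0_mule_fsumr// lee_wpmul2l ?lee_fin//.
by apply: esum_ge; exists X.
Qed.

Lemma l2norm_sqrZ a x : l2norm (a *: x) ^+ 2 <= Normc.normc a ^+ 2 * l2norm x ^+ 2.
Proof.
rewrite -lee_fin (EFinM (Normc.normc a ^+ 2)) !l2norm_sqr.
apply: le_trans (esum_le_mull _ _ _) => //.
- by apply: le_esum => i _; rewrite -EFinM l2ZE Normc.normcM exprMn.
- exact: sqr_ge0.
- by move=> i; rewrite lee_fin sqr_ge0.
Qed.

Lemma normc_ge0 (z : R[i]) : 0 <= Normc.normc z.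
Proof. by case: z => a b; exact: sqrtr_ge0. Qed.

(** Holds termwise, since 2u^2 + 2v^2 - (u + v)^2 = (u - v)^2. The constant 2 is harmless for
    boundedness, and it spares the triangle inequality for [l2norm]. *)
Lemma l2norm_sqrD x y :
  l2norm (x + y) ^+ 2 <= 2 * l2norm x ^+ 2 + 2 * l2norm y ^+ 2.
Proof.
rewrite -lee_fin EFinD !(EFinM 2) !l2norm_sqr.
have sq0 (z : l2 R I) i : (0 <= (Normc.normc (z i) ^+ 2)%R%:E)%E.
  by rewrite lee_fin sqr_ge0.
apply: le_trans (leeD (esum_le_mull _ _ (sq0 x)) (esum_le_mull _ _ (sq0 y))) => //.
rewrite -esumD; [|by move=> i _; rewrite mule_ge0..].
apply: le_esum => i _; rewrite -!EFinM -EFinD lee_fin l2DE.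
have sq_le (s u v : R) : 0 <= s -> s <= u + v -> s ^+ 2 <= 2 * u ^+ 2 + 2 * v ^+ 2.
  move=> s0 suv; apply: (le_trans (lerXn2r 2 s0 (le_trans s0 suv) suv)).
  rewrite -subr_ge0 (_ : _ - _ = (u - v) ^+ 2); last by ring.
  exact: sqr_ge0.
exact: sq_le (normc_ge0 _) (le_normcD _ _).
Qed.

End L2.

(** * Bounded operators and finite-rank perturbations of the identity *)

Section BoundedOperators.
Variables (R : realType) (I : choiceType).
Local Notation op := {linear l2 R I -> l2 R I}.

(** Squared norms are sums of nonnegative terms and can be compared term by term, so every later
    bound is proved in this form. *)
Lemma bounded_op_sqrP (A : op) : bounded_op A <->
  exists2 M : R, 0 <= M & forall x, l2norm (A x) ^+ 2 <= M * l2norm x ^+ 2.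
Proof.
split=> [[M AM]|[M M0 AM]].
  exists (M ^+ 2); first exact: sqr_ge0.
  move=> x; have Ax0 := l2norm_ge0 (A x); rewrite -exprMn.
  exact: (lerXn2r 2 Ax0 (le_trans Ax0 (AM x)) (AM x)).
exists (Num.sqrt M) => x.
rewrite -(@ler_pXn2r _ 2)// ?nnegrE ?mulr_ge0 ?sqrtr_ge0 ?l2norm_ge0//.
by rewrite exprMn (sqr_sqrtr M0); exact: AM.
Qed.

Lemma bounded_op_id : bounded_op (idfun : op).
Proof. by exists 1 => x; rewrite mul1r. Qed.

Lemma bounded_op_comp (A B : op) :
  bounded_op A -> bounded_op B -> bounded_op (A \o B : op).
Proof.
move=> /bounded_op_sqrP[M M0 AM] /bounded_op_sqrP[N N0 BN].
apply/bounded_op_sqrP; exists (M * N); first exact: mulr_ge0.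
move=> x; apply: le_trans (AM _) _; rewrite -mulrA ler_wpM2l//; exact: BN.
Qed.

(** For injective [e] and [g k = v k - ket R (e k)], this operator sends each [ket R (e k)] to
    [v k]. *)
Definition finite_rank_update r (e : 'I_r -> I) (g : 'I_r -> l2 R I) (x : l2 R I) :=
  x + \sum_(k < r) x (e k) *: g k.

Section FiniteRankUpdate.
Variables (r : nat) (e : 'I_r -> I).
Implicit Types g h : 'I_r -> l2 R I.

Lemma finite_rank_update_linear g : linear (finite_rank_update e g).
Proof.
move=> a x y; rewrite /finite_rank_update scalerDr scaler_sumr addrACA -big_split.
congr (_ + _); apply: eq_bigr => k _.
by rewrite l2DE l2ZE scalerDl scalerA.
Qed.

HB.instance Definition _ g := GRing.isLinear.Build _ _ _ _
  (finite_rank_update e g) (finite_rank_update_linear g).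

Lemma bounded_finite_rank_update g : bounded_op (finite_rank_update e g : op).
Proof.
apply/bounded_op_sqrP.
(* Arbitrary lists of indices allow the rank-one terms to be added one at a time. *)
suff sumM (s : seq 'I_r) : exists2 M : R, 0 <= M & forall x : l2 R I,
    l2norm (x + \sum_(k <- s) x (e k) *: g k) ^+ 2 <= M * l2norm x ^+ 2.
  exact: sumM.
elim: s => [|k s [M M0 IH]].
  by exists 1 => // x; rewrite big_nil addr0 mul1r.
(* The new rank-one term has norm at most that of [g k] times that of [x], because a coordinate is
   bounded by the norm. *)
exists (2 * l2norm (g k) ^+ 2 + 2 * M).
  by apply: addr_ge0; apply: mulr_ge0 => //; exact: sqr_ge0.
move=> x; rewrite big_cons addrCA.
apply: (le_trans (l2norm_sqrD _ _)).
rewrite (mulrDl (2 * l2norm (g k) ^+ 2)) -(mulrA 2 (l2norm (g k) ^+ 2)) -(mulrA 2 M).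
apply: lerD; apply: ler_wpM2l => //.
apply: (le_trans (l2norm_sqrZ _ _)).
rewrite [X in _ <= X]mulrC; apply: ler_wpM2r; [exact: sqr_ge0|exact: coord_le_l2norm].
Qed.

(** After expanding the composite and exchanging the sums, the hypothesis says that the vector
    multiplying each coordinate [x (e n)] vanishes. *)
Lemma finite_rank_updateK g h :
  (forall n, h n + g n + \sum_(l < r) h n (e l) *: g l = 0) ->
  cancel (finite_rank_update e h) (finite_rank_update e g).
Proof.
move=> gh x; rewrite /finite_rank_update.
under [X in _ + _ + X]eq_bigr => l _.
  rewrite l2DE l2_sumE scalerDl scaler_suml; over.
rewrite big_split/= exchange_big/= -addrA -!big_split/= big1 ?addr0// => n _.
under eq_bigr => l _ do rewrite l2ZE -scalerA.
by rewrite -scaler_sumr -!scalerDr addrA gh scaler0.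
Qed.

End FiniteRankUpdate.
End BoundedOperators.

(** * Operators acting on one mode, and their tensor products *)

Section ModeOperators.
Variables (R : realType) (m : nat) (k : 'I_m).
Implicit Types (n p : occupation m) (x : multimode R m).

Definition set_mode n (j : nat) : occupation m :=
  [ffun i => if i == k then j else n i].

Lemma set_modeK n : set_mode n (n k) = n.
Proof. by apply/ffunP => i; rewrite ffunE; case: eqP => [->|]. Qed.

Lemma set_mode_at n j : set_mode n j k = j.
Proof. by rewrite ffunE eqxx. Qed.

Lemma set_mode_idem n i j : set_mode (set_mode n i) j = set_mode n j.
Proof. by apply/ffunP => l; rewrite !ffunE; case: (l == k). Qed.

Lemma slice_sqsummable n x : sqsummable (fun j => x (set_mode n j)).
Proof.
have /sqsummableP[M xM] := l2valP x; apply/sqsummableP; exists M => J.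
have := xM [fset set_mode n j | j in J]%fset.
rewrite big_imfset//= => i j _ _ ij.
by rewrite -(set_mode_at n i) ij set_mode_at.
Qed.

Definition slice n x : fock R := L2 (slice_sqsummable n x).

Lemma slice_linear n : linear (slice n).
Proof. by move=> a x y; apply: l2P. Qed.

HB.instance Definition _ n := GRing.isLinear.Build _ _ _ _ (slice n) (slice_linear n).

Lemma slice_set_mode n j x : slice (set_mode n j) x = slice n x.
Proof. by apply: l2P => i; rewrite /slice /l2val set_mode_idem. Qed.

Local Notation base := [set p : occupation m | p k = 0%N]%classic.

(** The lines in direction [k] partition the occupations, and each meets [base] in exactly one
    point, so the sum can be taken line by line. *)
Lemma sqsum_slices (y : occupation m -> R[i]) :
  sqsum y = (\esum_(p in base) sqsum (fun j => y (set_mode p j)))%E.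
Proof.
rewrite /sqsum esum_esum; last by move=> *; rewrite lee_fin sqr_ge0.
apply: (reindex_esum _ _ (fun q : occupation m * nat => set_mode q.1 q.2)).
split=> //.
- move=> [p i] [q j]; rewrite !inE /= => -[p0 _] [q0 _] pq.
  congr pair; last by rewrite -(set_mode_at p i) pq set_mode_at.
  by rewrite -(set_modeK p) -(set_modeK q) p0 q0 -(set_mode_idem p i) pq set_mode_idem.
- move=> n _; exists (set_mode n 0, n k) => /=; last by rewrite set_mode_idem set_modeK.
  by split => //=; rewrite set_mode_at.
Qed.

Variables (A : {linear fock R -> fock R}) (A_bounded : bounded_op A).

(** [A] acts on each slice separately with one common bound, and the slices add up by
    [sqsum_slices]. *)
Lemma sqsum_on_mode : exists2 M : R, 0 <= M & forall x,
  (sqsum (fun n => A (slice n x) (n k)) <= M%:E * sqsum x)%E.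
Proof.
have /bounded_op_sqrP[M M0 AM] := A_bounded; exists M => // x.
rewrite !sqsum_slices; apply: le_trans (esum_le_mull _ M0 (fun=> sqsum_ge0 _)).
apply: le_esum => p _.
rewrite -[X in (_ <= _ * X)%E]/(sqsum (slice p x)) -l2norm_sqr -EFinM.
apply: (@le_trans _ _ (sqsum (A (slice p x)))); last first.
  by rewrite -l2norm_sqr lee_fin.
apply: le_esum => j _; rewrite slice_set_mode set_mode_at//.
Qed.

Lemma on_mode_sqsummable x : sqsummable (fun n => A (slice n x) (n k)).
Proof.
have [M _ AM] := sqsum_on_mode; apply: le_lt_trans (AM x) _.
by rewrite -l2norm_sqr -EFinM ltry.
Qed.

(** This is [A] on mode [k] tensored with the identity on the others. Giving it by entries defines
    it on all vectors at once, with no extension by density from product vectors. *)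
Definition on_mode x : multimode R m := L2 (on_mode_sqsummable x).

Lemma on_mode_linear : linear on_mode.
Proof.
move=> a x y; apply: l2P => n; rewrite l2DE l2ZE.
by rewrite -[LHS]/(A (slice n (a *: x + y)) (n k)) !linearP.
Qed.

HB.instance Definition _ := GRing.isLinear.Build _ _ _ _ on_mode on_mode_linear.

Lemma bounded_on_mode : bounded_op (on_mode : {linear _ -> _}).
Proof.
apply/bounded_op_sqrP; have [M M0 AM] := sqsum_on_mode; exists M => // x.
by rewrite -lee_fin (EFinM M) !l2norm_sqr; exact: AM.
Qed.

(** Each slice of a product vector is a scalar multiple of its factor [f k], so linearity of [A]
    suffices. *)
Lemma on_mode_tensor (f : 'I_m -> fock R) :
  on_mode (tensor f) = tensor (fun i => if i == k then A (f i) else f i).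
Proof.
apply: l2P => n.
have -> : tensor (fun i => if i == k then A (f i) else f i) n =
    \prod_(i < m) (if i == k then A (f i) else f i) (n i) by [].
have -> : on_mode (tensor f) n = A (slice n (tensor f)) (n k) by [].
have -> : slice n (tensor f) = (\prod_(i < m | i != k) f i (n i)) *: f k.
  apply: l2P => j; rewrite l2ZE.
  have -> : slice n (tensor f) j = \prod_(i < m) f i (set_mode n j i) by [].
  rewrite (bigD1 k)//= set_mode_at mulrC; congr (_ * _).
  by apply: eq_bigr => i /negbTE ik; rewrite ffunE ik.
rewrite linearZ l2ZE [RHS](bigD1 k)//= eqxx mulrC; congr (_ * _).
by apply: eq_bigr => i /negbTE ->.
Qed.

End ModeOperators.

(** The tensor product is the composite of the one-mode operators. Running through a duplicate-free
    list of modes ensures that each [A k] is applied exactly once. *)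
Lemma tensor_op_exists (R : realType) (m : nat)
    (A : 'I_m -> {linear fock R -> fock R}) :
  (forall k, bounded_op (A k)) ->
  exists T : {linear multimode R m -> multimode R m}, is_tensor_op A T.
Proof.
move=> A_bounded.
suff H (s : seq 'I_m) : uniq s ->
    exists2 T : {linear multimode R m -> multimode R m}, bounded_op T &
    forall f, T (tensor f) = tensor (fun k => if k \in s then A k (f k) else f k).
  have [T Tb TE] := H _ (enum_uniq 'I_m); exists T; split=> // f.
  rewrite TE; congr tensor; apply/funext => k.
  by rewrite mem_enum.
elim: s => [_|k s IH /=/andP[ks /IH[T Tb TE]]].
  by exists idfun => //; exact: bounded_op_id.
exists (on_mode k (A_bounded k) \o T : {linear _ -> _}).
  by apply: bounded_op_comp => //; exact: bounded_on_mode.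
move=> f; rewrite /= TE on_mode_tensor; congr tensor; apply/funext => i.
by rewrite inE; case: eqP => [->|]//=; rewrite (negbTE ks).
Qed.

(** * Invertible one-mode operators that turn coherent states into number states *)

Section Straightening.
Variables (R : realType) (r : nat).

(** The update by [h] sends number states to the [v k]; the operator sought is its inverse. Only the
    leading r-by-r block [G] of coordinates decides invertibility, whatever the tails of the [v k]
    are. *)
Lemma bounded_invertible_to_kets (v : 'I_r -> fock R) :
  \matrix_(i < r, j < r) v i j \in unitmx ->
  exists2 A : {linear fock R -> fock R}, bounded_invertible A &
    forall k, A (v k) = ket R (k : nat).
Proof.
set G := \matrix_(i, j) _ => Gunit.
pose e (k : 'I_r) : nat := k.
pose h k := v k - ket R (e k).
(* Since h_n(l) = G_nl - delta_nl, the condition of [finite_rank_updateK] reduces to h_n + sum_l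
   G_nl g_l = 0, whose solution is g = -G^(-1) h. *)
pose g l := - \sum_(j < r) invmx G l j *: h j.
have h_coord n l : h n (e l) = G n l - (n == l)%:R.
  by rewrite /h l2DE l2NE ketE mxE eq_sym.
have hg : cancel (finite_rank_update e h) (finite_rank_update e g).
  apply: finite_rank_updateK => n.
  have -> : \sum_(l < r) h n (e l) *: g l =
      - \sum_(j < r) ((G - 1%:M) *m invmx G) n j *: h j.
    rewrite /g (eq_bigr _ (fun l _ => scalerN _ _)) sumrN; congr (- _).
    under eq_bigr do rewrite scaler_sumr.
    rewrite exchange_big; apply: eq_bigr => j _.
    rewrite mxE scaler_suml; apply: eq_bigr => l _.
    by rewrite scalerA h_coord !mxE.
  rewrite mulmxBl mulmxV// mul1mx.
  have BE j : (1%:M - invmx G) n j = (n == j)%:R - invmx G n j by rewrite !mxE.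
  under eq_bigr => j _ do rewrite BE scalerBl.
  rewrite sumrB opprB addrA addrNK (bigD1 n)//= eqxx scale1r big1 ?addr0 ?subrr// => j.
  by rewrite eq_sym => /negbTE->; rewrite scale0r.
(* In infinite dimension a one-sided inverse is not enough. This order uses that [invmx G] is also a
   left inverse of [G]. *)
have gh : cancel (finite_rank_update e g) (finite_rank_update e h).
  apply: finite_rank_updateK => n.
  have g_coord l : g n (e l) = invmx G n l - (n == l)%:R.
    rewrite /g l2NE l2_sumE.
    have -> : \sum_(j < r) (invmx G n j *: h j) (e l) = (invmx G *m (G - 1%:M)) n l.
      by rewrite mxE; apply: eq_bigr => j _; rewrite l2ZE h_coord !mxE.
    by rewrite mulmxBr mulVmx// mulmx1 !mxE opprB.
  under [X in _ + X]eq_bigr => l _ do rewrite g_coord scalerBl.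
  rewrite sumrB addrACA /g addNr add0r.
  rewrite (bigD1 n)//= eqxx scale1r big1 ?addr0 ?subrr// => j.
  by rewrite eq_sym => /negbTE->; rewrite scale0r.
exists (finite_rank_update e g : {linear _ -> _}).
  split; first exact: bounded_finite_rank_update.
  exists (finite_rank_update e h : {linear _ -> _}); split=> //.
  exact: bounded_finite_rank_update.
move=> k; rewrite -[RHS]hg; congr (finite_rank_update _ _ _).
rewrite /finite_rank_update (bigD1 k)//= ketE eqxx scale1r big1 ?addr0.
  by rewrite addrC subrK.
by move=> j jk; rewrite ketE (inj_eq val_inj) (negbTE jk) scale0r.
Qed.

(** The first [r] coordinates of the coherent states form a transposed Vandermonde matrix between
    two invertible diagonal ones: Gaussian prefactors (with the inverse scalings) on the left,
    inverse square roots of factorials on the right. *)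
Lemma coherent_to_kets (beta d : 'I_r -> R[i]) :
  injective beta -> (forall k, d k != 0) ->
  exists2 A : {linear fock R -> fock R}, bounded_invertible A &
    forall k, A (coherent (beta k)) = d k *: ket R (k : nat).
Proof.
move=> beta_inj d_neq0.
have [|A A_inv AE] := @bounded_invertible_to_kets (fun k => (d k)^-1 *: coherent (beta k)).
  pose w k := (d k)^-1 * (expR (- (Normc.normc (beta k) ^+ 2) / 2))%:C.
  have -> : \matrix_(i < r, j < r) ((d i)^-1 *: coherent (beta i)) j =
      diag_mx (\row_i w i) *m (Vandermonde r (\row_i beta i))^T
        *m diag_mx (\row_(j < r) ((Num.sqrt (j`!)%:R)%:C)^-1).
    rewrite mul_mx_diag mul_diag_mx; apply/matrixP => i j.
    by rewrite !mxE l2ZE /w -!mulrA.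
  have unit_diag (a : 'rV[R[i]]_r) : (forall i, a 0 i != 0) -> diag_mx a \in unitmx.
    by move=> a0; rewrite unitmxE det_diag unitfE; apply/prodf_neq0 => i _.
  rewrite !unitmx_mul unitmx_tr; apply/andP; split; first (apply/andP; split).
  - apply: unit_diag => i; rewrite mxE mulf_neq0 ?invr_eq0//.
    by rewrite (inj_eq (@complexI _)) gt_eqF// expR_gt0.
  - rewrite unitmxE det_Vandermonde unitfE; apply/prodf_neq0 => i _.
    apply/prodf_neq0 => j ij; rewrite !mxE subr_eq0 (inj_eq beta_inj).
    by rewrite -val_eqE gtn_eqF.
  - apply: unit_diag => i; rewrite mxE invr_eq0 (inj_eq (@complexI _)).
    by rewrite gt_eqF// sqrtr_gt0 ltr0n fact_gt0.
exists A => // k.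
by rewrite -AE -linearZ/= scalerA mulfV// scale1r.
Qed.

End Straightening.

(** * Inner products with at most one nonzero term *)

Section InnerProduct.
Variables (R : realType) (I : choiceType).
Implicit Types x y : l2 R I.

(** The partial sums are constant on all finite sets containing [i0], so the limit is immediate. *)
Lemma ip_single x y i0 :
  (forall i, i != i0 -> (x i)^* * y i = 0) -> ip x y = (x i0)^* * y i0.
Proof.
move=> xy0; apply: cvg_sum.
have F := @summability.totally_filter I.
apply: cvg_near_cst.
exists [fset i0]%fset => //= J /= iJ; apply/eqP.
rewrite /summability.partial_sum.
rewrite -(big_seq_fsetE _ _ xpredT (fun k => ((x k)^* * y k : R[i])))/=.
rewrite (big_fsetD1 i0) ?(fsubsetP iJ) ?inE//= big_seq big1 ?addr0// => k.
by rewrite !inE => /andP[ki _]; exact: xy0.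
Qed.

Lemma ip_ketl i y : ip (ket R i) y = y i.
Proof.
rewrite (ip_single (i0 := i)); first by rewrite ketE eqxx conjC1 mul1r.
by move=> j /negbTE ji; rewrite ketE ji conjC0 mul0r.
Qed.

Lemma ip_ketr i x : ip x (ket R i) = (x i)^*.
Proof.
rewrite (ip_single (i0 := i)); first by rewrite ketE eqxx mulr1.
by move=> j /negbTE ji; rewrite ketE ji mulr0.
Qed.

End InnerProduct.

(** * The action of a balanced beam-splitter on one-port inputs *)

Section BeamSplitter.
Variables (R : realType) (m : nat).
Implicit Types n p : occupation m.

Local Notation sqrtC n := ((Num.sqrt n%:R)%:C).

Lemma sqrtC_neq0 (n : nat) : (0 < n)%N -> sqrtC n != 0 :> R[i].
Proof. by move=> n0; rewrite (inj_eq (@complexI _)) gt_eqF// sqrtr_gt0 ltr0n. Qed.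

Lemma sqrtC_sqr (n : nat) : sqrtC n * sqrtC n = n%:R :> R[i].
Proof. by rewrite -rmorphM/= -expr2 sqr_sqrtr ?ler0n// rmorph_nat. Qed.

Definition photons n : nat := (\sum_(k < m) n k)%N.

Definition inv_sqrt_fact n : R[i] := \prod_(k < m) ((Num.sqrt ((n k)`!)%:R)%:C)^-1.

(** The amplitude enters only through the total photon number, which is what makes a beam-splitter
    output recognizable as such a product. *)
Lemma tensor_coherentE (beta : R[i]) n :
  tensor (fun=> coherent beta) n =
  (expR (- (Normc.normc beta ^+ 2) / 2))%:C ^+ m * beta ^+ photons n * inv_sqrt_fact n.
Proof.
rewrite -[LHS]/(\prod_(k < m) ((expR (- (Normc.normc beta ^+ 2) / 2))%:C *
      (beta ^+ n k / (Num.sqrt ((n k)`!)%:R)%:C))).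
by rewrite !big_split/= prodr_const card_ord -expr_sum mulrA.
Qed.

(* Domination by the m-fold product of the coherent state of amplitude 1. *)
Lemma weighted_sqsummable (g : occupation m -> nat) (M : nat) :
  (forall n, (g n <= M)%N) -> sqsummable (fun n => (g n)%:R * inv_sqrt_fact n).
Proof.
move=> gM; pose E := (expR (- (Normc.normc (1 : R[i]) ^+ 2) / 2))%:C ^+ m.
have E0 : E != 0 by rewrite expf_neq0// (inj_eq (@complexI _)) gt_eqF// expR_gt0.
have /sqsummableP[B DB] :=
  l2valP (E^-1 *: tensor (fun=> coherent (1 : R[i]) : fock R) : multimode R m).
apply/sqsummableP; exists (M%:R ^+ 2 * B) => J.
apply: le_trans (ler_wpM2l _ (DB J)); last exact: sqr_ge0.
rewrite mulr_sumr; apply: ler_sum => n _.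
rewrite l2ZE tensor_coherentE expr1n mulr1 mulKf//.
rewrite Normc.normcM exprMn; apply: ler_wpM2r; first exact: sqr_ge0.
have -> : Normc.normc ((g n)%:R : R[i]) = (g n)%:R.
  by rewrite -(rmorph_nat (@real_complex R)) /= expr0n addr0 sqrtr_sqr normr_nat.
by rewrite lerXn2r ?nnegrE ?ler0n// ler_nat.
Qed.

(** By the multinomial formula, this is the N-th power of the sum of all creation operators applied
    to the vacuum, divided by N!. *)
Definition layer (N : nat) : multimode R m :=
  L2 (weighted_sqsummable (fun n => leq_b1 (photons n == N))).

Lemma layerE N n : layer N n = (photons n == N)%:R * inv_sqrt_fact n.
Proof. by []. Qed.

Lemma photons_remove (k : 'I_m) n : (0 < n k)%N ->
  photons n = (photons (remove_one k n)).+1.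
Proof.
move=> nk; rewrite /photons (bigD1 k)//= [in RHS](bigD1 k)//= ffunE eqxx.
rewrite -addSn prednK//; congr addn.
by apply: eq_bigr => i /negbTE ik; rewrite ffunE ik.
Qed.

Lemma inv_sqrt_fact_remove (k : 'I_m) n : (0 < n k)%N ->
  inv_sqrt_fact (remove_one k n) = (Num.sqrt (n k)%:R)%:C * inv_sqrt_fact n.
Proof.
move=> nk; rewrite /inv_sqrt_fact (bigD1 k)//= [in RHS](bigD1 k)//= mulrA.
congr (_ * _); last by apply: eq_bigr => i /negbTE ik; rewrite ffunE ik.
rewrite ffunE eqxx; case: (n k) nk => //= j _.
rewrite factS natrM sqrtrM ?ler0n// rmorphM/= invfM mulrA mulfV ?mul1r//.
by rewrite (inj_eq (@complexI _)) gt_eqF// sqrtr_gt0 ltr0n.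
Qed.

(** One factor sqrt(n_k) comes from creation and one from the change of factorial, giving the weight
    [n k]; over all modes these weights add up to N + 1. *)
Lemma creation_layer (k : 'I_m) N :
  exists y : multimode R m, creation k (layer N) y /\
    forall n, y n = (n k)%:R * layer N.+1 n.
Proof.
have gM n : ((photons n == N.+1) * n k <= N.+1)%N.
  case: eqP => [<-|]//=; rewrite mul1n /photons (bigD1 k)//=; exact: leq_addr.
exists (L2 (weighted_sqsummable gM)); split=> n; last first.
  by rewrite layerE mulrA -natrM mulnC.
rewrite -[LHS]/(((photons n == N.+1) * n k)%N%:R * inv_sqrt_fact n) layerE natrM.
(* For an empty mode [remove_one] leaves the occupation unchanged, but the factor sqrt(0) removes
   this term. *)
have [->|nk] := posnP (n k); first by rewrite sqrtr0 !(mulr0, mul0r).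
rewrite (photons_remove nk) eqSS inv_sqrt_fact_remove// mulrCA.
by rewrite (mulrA (Num.sqrt _)%:C) sqrtC_sqr mulrA.
Qed.

Variable k1 : 'I_m.

Definition port_occupation (j : nat) : occupation m :=
  [ffun i => if i == k1 then j else 0%N].

Lemma one_port_inputE (f : fock R) n :
  one_port_input k1 f n = (n == port_occupation (n k1))%:R * f (n k1).
Proof.
rewrite -[LHS]/(\prod_(k < m) (if k == k1 then f else ket R 0%N) (n k)).
rewrite (bigD1 k1)//= eqxx mulrC; congr (_ * _).
have [nE|/eqP nE] := eqVneq n.
  by rewrite big1// => k /negbTE kk1; rewrite kk1 nE ketE ffunE kk1.
have [/forallP n0|] := boolP [forall k, (k != k1) ==> (n k == 0%N)].
  case: nE; apply/ffunP => k; rewrite ffunE; case: eqP => [->//|/eqP kk1].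
  by have := n0 k; rewrite kk1/= => /eqP.
rewrite negb_forall => /existsP[k]; rewrite negb_imply => /andP[kk1 nk].
by rewrite (bigD1 k)//= (negbTE kk1) ketE (negbTE nk) mul0r.
Qed.

Lemma one_port_input_ket j : one_port_input k1 (ket R j) = ket R (port_occupation j).
Proof.
apply: l2P => n; rewrite one_port_inputE !ketE -natrM mulnb; congr ((nat_of_bool _)%:R).
have [->|nj] := eqVneq n (port_occupation j); first by rewrite ffunE eqxx !eqxx.
by apply/negP => /andP[/eqP nE /eqP kj]; case/eqP: nj; rewrite nE kj.

Qed.

Lemma one_port_input_linear : linear (one_port_input (R := R) k1).
Proof.
move=> a f g; apply: l2P => n.
by rewrite l2DE l2ZE !one_port_inputE l2DE l2ZE mulrDr mulrCA.
Qed.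

HB.instance Definition _ := GRing.isLinear.Build _ _ _ _
  (one_port_input (R := R) k1) one_port_input_linear.

Lemma vacuumE : vacuum R m = ket R (port_occupation 0).
Proof.
rewrite -one_port_input_ket; congr tensor; apply/funext => k.
by case: eqP.
Qed.

Lemma layer0 : layer 0 = vacuum R m.
Proof.
rewrite vacuumE; apply: l2P => n; rewrite layerE ketE.
have [->|n0] := eqVneq n.
  rewrite /photons big1 ?eqxx ?mul1r; last by move=> k _; rewrite ffunE; case: eqP.
  rewrite /inv_sqrt_fact big1// => k _; rewrite ffunE; case: eqP => _;
  by rewrite fact0 sqrtr1 rmorph1 invr1.
case: eqP => [/eqP|]; last by rewrite mul0r.
rewrite /photons sum_nat_eq0 => /forallP n0'; case/eqP: n0; apply/ffunP => k.
by rewrite ffunE; have /eqP -> := n0' k; case: eqP.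
Qed.

Lemma creation_port j z :
  creation k1 (ket R (port_occupation j)) z ->
  z = (Num.sqrt j.+1%:R)%:C *: ket R (port_occupation j.+1).
Proof.
move=> zE; apply: l2P => n; rewrite zE l2ZE !ketE.
have [->|nj] := eqVneq n (port_occupation j.+1).
  rewrite ffunE eqxx (_ : remove_one _ _ = port_occupation j) ?eqxx//.
  by apply/ffunP => k; rewrite !ffunE; case: eqP.
case: eqP => [rE|]; last by rewrite !mulr0.
have [->|nk] := posnP (n k1); first by rewrite sqrtr0 mulr0 mul0r.
case/eqP: nj; apply/ffunP => k; move/ffunP/(_ k): rE; rewrite !ffunE.
by case: eqP => // -> <-; rewrite prednK.
Qed.

Hypothesis m_gt0 : (0 < m)%N.
Variables U V : {linear multimode R m -> multimode R m}.
Hypothesis UV : balanced_beam_splitter k1 U V.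

Lemma splitter_port N :
  U (ket R (port_occupation N)) = (sqrtC (N`!) / sqrtC m ^+ N) *: layer N.
Proof.
have [[_ UK _] Uvac Ucre] := UV.
elim: N => [|N IH].
  by rewrite -vacuumE Uvac layer0 fact0 sqrtr1 rmorph1 expr0 divr1 scale1r.
set a := _ / _ in IH.
have [Y YE] := choice (fun k => creation_layer k N).
(* By the induction hypothesis this vector is the image of N photons in the port, so [V] takes it
   back there and creation in [k1] adds the next photon. *)
have [|z zc Uz] := Ucre (a *: layer N) (fun k => a *: Y k).
  by move=> k n; rewrite !l2ZE (YE k).1 mulrCA.
move: zc Uz; rewrite -IH UK => /creation_port->.
rewrite linearZ/= -scaler_sumr.
have -> : \sum_(k < m) Y k = N.+1%:R *: layer N.+1.
  apply: l2P => n; rewrite l2_sumE l2ZE.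
  under eq_bigr => k _ do rewrite (YE k).2.
  rewrite -mulr_suml -natr_sum layerE -/(photons n).
  by case: eqP => [->//|]; rewrite !mul0r !mulr0.
move=> /(congr1 (fun x => (sqrtC N.+1)^-1 *: x)).
rewrite !scalerA mulVf ?sqrtC_neq0// scale1r => ->; congr (_ *: _).
rewrite /a factS natrM sqrtrM ?ler0n// rmorphM/= exprS -(sqrtC_sqr N.+1) fmorphV/=.
by field; rewrite !sqrtC_neq0 // expf_neq0 // sqrtC_neq0.
Qed.

(* Matrix elements of [U] are read off through its adjoint, so that no
   continuity argument is needed. *)
Lemma splitter_one_port (f : fock R) n :
  U (one_port_input k1 f) n =
  f (photons n) * (sqrtC ((photons n)`!) / sqrtC m ^+ photons n * inv_sqrt_fact n).
Proof.
have [[Uadj _ _] _ _] := UV.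
have Vket N : V (ket R n) (port_occupation N) =
    ((sqrtC (N`!) / sqrtC m ^+ N) * layer N n)^*.
  by rewrite -ip_ketl -Uadj splitter_port ip_ketr l2ZE.
rewrite -[LHS]conjcK -[RHS]conjcK; congr (_ ^*); rewrite -ip_ketr Uadj.
rewrite (ip_single (i0 := port_occupation (photons n))).
  rewrite one_port_inputE Vket layerE ffunE eqxx !eqxx !mul1r.
  by rewrite [RHS]rmorphM.
move=> p pn; rewrite one_port_inputE.
have [pE|] := eqVneq; last by rewrite mul0r rmorph0 mul0r.
rewrite pE Vket layerE ffunE eqxx; case: eqP => [pk|]; last first.
  by rewrite mul0r mulr0 rmorph0 mulr0.
by case/eqP: pn; rewrite pE -pk.
Qed.

Lemma splitter_coherent (alpha : R[i]) :
  U (one_port_input k1 (coherent alpha)) = tensor (fun=> coherent (alpha / sqrtC m)).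
Proof.
apply: l2P => n; rewrite splitter_one_port tensor_coherentE.
set T := photons n.
rewrite -[coherent alpha T]/((expR (- (Normc.normc alpha ^+ 2) / 2))%:C *
      (alpha ^+ T / sqrtC T`!)).
(* The [m] Gaussian prefactors, each with |alpha|^2 / m in its exponent, multiply to the prefactor
   of the input. *)
have -> : (expR (- (Normc.normc (alpha / sqrtC m) ^+ 2) / 2))%:C ^+ m =
    (expR (- (Normc.normc alpha ^+ 2) / 2))%:C.
  rewrite -rmorphXn/= -expRM_natl; congr ((expR _)%:C).
  have -> : Normc.normc (alpha / sqrtC m) ^+ 2 = Normc.normc alpha ^+ 2 / m%:R.
    rewrite Normc.normcM Normc.normcV exprMn exprVn; congr (_ / _).
    by rewrite /= expr0n addr0 sqr_sqrtr ?sqr_ge0// sqr_sqrtr.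
  by field; rewrite pnatr_eq0 -lt0n.
rewrite exprMn exprVn; field.
by rewrite expf_neq0 ?sqrtC_neq0// fact_gt0.
Qed.

End BeamSplitter.

(** * Absorbing the coefficients in one mode, and the equivalence with GHZ *)

Lemma tensor_scale_mode (R : realType) (m : nat) (k : 'I_m) (a : R[i])
    (f : 'I_m -> fock R) :
  tensor (fun i => if i == k then a *: f i else f i) = a *: tensor f.
Proof.
apply: l2P => n; rewrite l2ZE.
rewrite -[LHS]/(\prod_(i < m) (if i == k then a *: f i else f i) (n i)).
rewrite -[tensor f n]/(\prod_(i < m) f i (n i)).
rewrite (bigD1 k)//= [in RHS](bigD1 k)//= eqxx l2ZE mulrA; congr (_ * _).
by apply: eq_bigr => i /negbTE ->.
Qed.

Theorem mainTheorem5 (R : realType) (m r : nat)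
    (hm : (2 <= m)%N) (hr : (1 <= r)%N)
    (alpha c : 'I_r -> R[i]) (N : R)
    (alpha_inj : injective alpha) (c_neq0 : forall k, c k != 0)
    (N_gt0 : 0 < N)
    (N_normalizes :
      l2norm (N^-1%:C *: \sum_(k < r) c k *: coherent (alpha k)) = 1) :
  let port1 : 'I_m := Ordinal (ltnW hm) in
  let beta k := alpha k / (Num.sqrt m%:R)%:C in
  let Psi : multimode R m :=
    N^-1%:C *: \sum_(k < r) c k *: tensor (fun=> coherent (beta k)) in
  (forall U V : {linear multimode R m -> multimode R m},
     balanced_beam_splitter port1 U V ->
     U (one_port_input port1
          (N^-1%:C *: \sum_(k < r) c k *: coherent (alpha k))) = Psi) /\
  slocc_equivalent Psi (ghz R m r).
Proof.
move=> port1 beta Psi.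
have m_gt0 : (0 < m)%N := ltnW hm.
have N_neq0 : N%:C != 0 by rewrite (inj_eq (@complexI _)) gt_eqF.
split=> [U V UV|].
  rewrite linearZ linear_sum linearZ linear_sum; congr (_ *: _).
  by apply: eq_bigr => k _; rewrite linearZ linearZ (splitter_coherent m_gt0 UV).
have beta_inj : injective beta.
  by move=> i j /(mulIf _) => /(_ (invr_neq0 (sqrtC_neq0 _ m_gt0))) /alpha_inj.
(* Chosen so that (c_k / N) d_k = 1 / sqrt(r), the GHZ coefficient. Only the first mode carries this
   scaling; the others use scaling 1. *)
pose d k := N%:C / (c k * (Num.sqrt r%:R)%:C).
have d_neq0 k : d k != 0.
  by rewrite mulf_neq0// invr_neq0// mulf_neq0// sqrtC_neq0.
have [A1 A1_inv A1E] := coherent_to_kets beta_inj d_neq0.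
have [A0 A0_inv A0E] := coherent_to_kets beta_inj (fun=> oner_neq0 _).
pose A (i : 'I_m) := if i == port1 then A1 else A0.
have A_inv i : bounded_invertible (A i) by rewrite /A; case: (i == port1).
exists A; split=> //.
have [T [T_bounded TE]] := tensor_op_exists (fun i => (A_inv i).1).
exists T => //; rewrite /ghz /Psi linearZ/= (linear_sum T)/=.
rewrite !scaler_sumr; apply: eq_bigr => k _.
rewrite linearZ/= TE.
have -> : (fun i => A i (coherent (beta k))) =
    (fun i => if i == port1 then d k *: ket R (k : nat) else ket R (k : nat)).
  by apply/funext => i; rewrite /A; case: eqP => _; rewrite ?A1E// A0E scale1r.
rewrite tensor_scale_mode !scalerA; congr (_ *: _).
rewrite /d !fmorphV/=; field.
by rewrite N_neq0 c_neq0 sqrtC_neq0.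
Qed.
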